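(* Suppose $\mathcal{X}$ is a discrete function space on a tree $T$ on which the differentiation operator $D$ is bounded. Then \[1-\|C_b\|\leq \|D\|\leq 1+\|C_b\|.\]
   Context: A tree $T$ is a locally finite, connected, simply-connected graph, identified with its set of vertices. A vertex is terminal if it has a unique neighbor; all trees are assumed to be without terminal vertices (hence infinite) and rooted at a vertex $o$. For $v\neq o$, $v^-$ denotes the unique neighbor of $v$ lying on the path from $o$ to $v$ (the parent of $v$). A function on $T$ is a complex-valued function on its vertices. The backward shift map $b:T\to T$ is $b(v)=v^-$ for $v\neq o$ and $b(o)=o$. The derivative of $f:T\to\mathbb{C}$ is $f'(v)=f(v)-f(b(v))$ for all $v\in T$ (so $f'(o)=0$). A functional Banach space on a set $\Omega$ is a Banach space of complex-valued functions on $\Omega$ with pointwise vector operations, such that $f(x)=g(x)$ for all $x\in\Omega$ implies $f=g$, $f(x)=f(y)$ for every $f$ in the space implies $x=y$, and for each $x\in\Omega$ the linear functional $f\mapsto f(x)$ is continuous. A discrete function space $\mathcal{X}$ on $T$ is a functional Banach space whose elements are functions on $T$, with norm $\|\cdot\|_{\mathcal{X}}$. The differentiation operator is $Df=f'$, and the composition operator induced by $b$ is $C_bf=f\circ b$. An operator is bounded on $\mathcal{X}$ if it is a bounded linear operator from $\mathcal{X}$ to $\mathcal{X}$; $\|D\|$ and $\|C_b\|$ are the operator norms on $\mathcal{X}$. ($D$ is bounded on $\mathcal{X}$ if and only if $C_b$ is.) *)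

(* Defs.v *)
(* Complex numbers are R[i] over a realType R of MathComp-Analysis. *)
From HB Require Import structures.
From mathcomp Require Import all_boot all_order all_algebra.
From mathcomp Require Import complex.
From mathcomp Require Import all_classical all_reals all_analysis.

Set Implicit Arguments.
Unset Strict Implicit.
Unset Printing Implicit Defensive.

Import Order.TTheory GRing.Theory Num.Theory.
Import numFieldNormedType.Exports.
Local Open Scope classical_set_scope.
Local Open Scope ring_scope.

(* A rooted tree without terminal vertices. Simple connectedness of the graph
   is the absence of simple cycles on three or more vertices (a "ucycle" of
   size two is an edge run back and forth). Infiniteness follows from the other
   fields except for the graph with a single vertex, whose vertex has no
   neighbor at all and hence is not terminal. *)
Record rooted_tree := RootedTree {
  vertex :> choiceType;
  adj : rel vertex;
  root : vertex;
  adj_sym : symmetric adj;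
  adj_irr : irreflexive adj;
  tree_connected : forall u v : vertex,
    exists p : seq vertex, path.path adj u p /\ last u p = v;
  tree_acyclic : forall c : seq vertex, ucycle adj c -> (size c <= 2)%N;
  tree_locally_finite : forall v : vertex, finite_set [set w | adj v w];
  tree_no_terminal : forall v : vertex, ~ exists! w : vertex, adj v w;
  tree_infinite : infinite_set [set: vertex] }.

Section Shift.
Variable T : rooted_tree.

Definition is_parent (v w : T) : Prop :=
  adj v w /\
  exists p : seq T,
    [/\ path.path (@adj T) (root T) p, uniq (root T :: p),
        last (root T) p = v & w \in root T :: p].

(* For v different from the root, is_parent v w holds for exactly one w, so the
   default value of xget is not used. *)
Definition parent (v : T) : T := xget (root T) [set w | is_parent v w].

Definition bshift (v : T) : T := if v == root T then root T else parent v.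

Variable R : realType.

Definition derivative (f : T -> R[i]) : T -> R[i] :=
  fun v => f v - f (bshift v).

Definition comp_shift (f : T -> R[i]) : T -> R[i] := f \o bshift.

End Shift.

(* A functional Banach space on Omega: a complex Banach space whose elements f
   are identified with the functions fun_of f. *)
Record functional_banach_space (R : realType) (Omega : Type) :=
  FunctionalBanachSpace {
  fbs_sort :> completeNormedModType R[i];
  fun_of : fbs_sort -> Omega -> R[i];
  fun_of_linear : forall (a : R[i]) (f g : fbs_sort) (x : Omega),
    fun_of (a *: f + g) x = a * fun_of f x + fun_of g x;
  fun_of_inj : forall f g : fbs_sort,
    (forall x : Omega, fun_of f x = fun_of g x) -> f = g;
  fun_of_separates : forall x y : Omega,
    (forall f : fbs_sort, fun_of f x = fun_of f y) -> x = y;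
  fun_of_continuous : forall x : Omega,
    continuous (fun f : fbs_sort => fun_of f x : R[i]^o) }.

Definition discrete_function_space (R : realType) (T : rooted_tree) :=
  functional_banach_space R T.

Section Operators.
Variables (R : realType) (Omega : Type) (X : functional_banach_space R Omega).
Variable L : (Omega -> R[i]) -> (Omega -> R[i]).

(* The library norm of X takes its values in R[i], as nonnegative reals. *)
Definition rnorm (f : X) : R := complex.Re `|f|.

(* L maps X into itself, and is a bounded linear operator there. *)
Definition bounded_on : Prop :=
  exists A : {linear X -> X},
    (forall f : X, fun_of (A f) = L (fun_of f)) /\
    (exists M : R, forall f : X, rnorm (A f) <= M * rnorm f).

(* The operator norm on X of L, meaningful when L is bounded on X:
   the supremum of the norms of L f for f in the closed unit ball of X. *)
Definition opnorm : R :=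
  sup [set r : R | exists f g : X,
    [/\ rnorm f <= 1, fun_of g = L (fun_of f) & r = rnorm g]].

End Operators.

(* Main.v *)
Require Import Defs.
From HB Require Import structures.
From mathcomp Require Import all_boot all_order all_algebra.
From mathcomp Require Import complex.
From mathcomp Require Import all_classical all_reals all_analysis.

(** Since [f' = f - f \o b], the differentiation operator is [D = I - C_b], and
    both inequalities are the triangle inequality for operator norms: the upper
    bound applied to [D = I - C_b], the lower bound to [I = D + C_b].
    The lower bound also needs [||I|| = 1], that is, a vector of norm [1] in the
    space; one exists because the tree has at least two vertices, which the
    space has to separate ([exists_unit_vector]).

    The argument concerns any two operators with sum [I] on a functional Banach
    space ([opnorm_complement_ub], [opnorm_complement_lb]).  The operator norm
    being a real supremum, it dominates the values over the unit ball only once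
    the operator is known to be bounded; this is why boundedness of [D] has to
    be transferred to [C_b] first ([bounded_on_complement]). *)

Set Implicit Arguments.
Unset Strict Implicit.
Unset Printing Implicit Defensive.

Import Order.TTheory GRing.Theory Num.Theory.
Import numFieldNormedType.Exports.
Local Open Scope ring_scope.

Section FunctionalBanachSpace.
Variables (R : realType) (Omega : Type) (X : functional_banach_space R Omega).
Implicit Types (f g : X) (L K : (Omega -> R[i]) -> (Omega -> R[i])).

Lemma rnormE f : (rnorm f)%:C%C = `|f|.
Proof. by rewrite /rnorm RRe_real // normr_real. Qed.

Lemma rnorm0 : rnorm (0 : X) = 0.
Proof. by rewrite /rnorm normr0. Qed.

Lemma rnorm_ge0 f : 0 <= rnorm f.
Proof. by rewrite -lecR rnormE normr_ge0. Qed.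

Lemma ler_rnormD f g : rnorm (f + g) <= rnorm f + rnorm g.
Proof. by rewrite -lecR rmorphD /= !rnormE ler_normD. Qed.

Lemma ler_rnormB f g : rnorm (f - g) <= rnorm f + rnorm g.
Proof. by rewrite -lecR rmorphD /= !rnormE ler_normB. Qed.

Lemma fun_ofB f g x : fun_of (f - g) x = fun_of f x - fun_of g x.
Proof. by rewrite addrC -scaleN1r fun_of_linear mulN1r addrC. Qed.

Lemma ler_opnorm L f g : bounded_on X L -> rnorm f <= 1 ->
  fun_of g = L (fun_of f) -> rnorm g <= opnorm X L.
Proof.
move=> [A [AL [M AM]]] f1 gL; apply: ub_le_sup; last by exists f, g.
exists `|M| => _ [h [k [h1 kL ->]]].
have -> : k = A h by apply: fun_of_inj => x; rewrite kL AL.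
rewrite (le_trans (AM h)) // (le_trans (ler_wpM2r (rnorm_ge0 h) (ler_norm M))) //.
by rewrite ler_piMr.
Qed.

(** Boundedness serves here to make the supremum range over a nonempty set:
    it provides an image of [0]. *)
Lemma opnorm_ler L (M : R) : bounded_on X L ->
  (forall f g, rnorm f <= 1 -> fun_of g = L (fun_of f) -> rnorm g <= M) ->
  opnorm X L <= M.
Proof.
move=> [A [AL _]] LM; apply: ge_sup => [|_ [f [g [f1 gL ->]]]]; last exact: LM gL.
by exists (rnorm (A 0)), 0, (A 0); rewrite rnorm0 ler01 AL.
Qed.

Lemma bounded_on_complement L K :
  (forall u x, K u x = u x - L u x) -> bounded_on X L -> bounded_on X K.
Proof.
move=> KE [A [AL [M AM]]]; exists (idfun \- A : {linear X -> X}); split.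
  by move=> f; apply/funext => x; rewrite /= fun_ofB AL KE.
by exists (1 + M) => f; rewrite mulrDl mul1r (le_trans (ler_rnormB _ _)) ?lerD2l.
Qed.

Lemma opnorm_complement_ub L K :
  (forall u x, K u x = u x - L u x) -> bounded_on X L -> bounded_on X K ->
  opnorm X L <= 1 + opnorm X K.
Proof.
move=> KE bL bK; apply: opnorm_ler => // f g f1 gL.
have KfE : fun_of (f - g) = K (fun_of f).
  by apply/funext => x; rewrite fun_ofB gL KE.
rewrite -[g](subKr f) (le_trans (ler_rnormB _ _)) //.
by rewrite lerD // (ler_opnorm bK f1 KfE).
Qed.

Lemma opnorm_complement_lb L K f : rnorm f = 1 ->
  (forall u x, K u x = u x - L u x) -> bounded_on X L -> bounded_on X K ->
  1 - opnorm X K <= opnorm X L.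
Proof.
move=> f1 KE bL bK; have [A [AL _]] := bL; have fle1 : rnorm f <= 1 by rewrite f1.
have KfE : fun_of (f - A f) = K (fun_of f).
  by apply/funext => x; rewrite fun_ofB AL KE.
rewrite lerBlDr -f1 -{1}[f](subrKC (A f)) (le_trans (ler_rnormD _ _)) //.
by rewrite lerD // ?(ler_opnorm bL fle1 (AL f)) ?(ler_opnorm bK fle1 KfE).
Qed.

(** Two distinct points are separated by some function, which is then nonzero
    and can be normalized. *)
Lemma exists_unit_vector (x y : Omega) : x <> y -> exists f : X, rnorm f = 1.
Proof.
move=> xy; have [f f0] : exists f : X, f != 0.
  apply: contrapT => X0; apply: xy; apply: (@fun_of_separates _ _ X) => f.
  have -> : f = f - f.
    by rewrite subrr; apply/eqP; apply/negP => /negP f0; apply: X0; exists f.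
  by rewrite !fun_ofB !subrr.
exists (`|f|^-1 *: f).
by rewrite /rnorm normrZ normfV normr_id mulVf ?normr_eq0.
Qed.

End FunctionalBanachSpace.

Lemma tree_two_vertices (T : rooted_tree) : exists v : T, v <> Defs.root T.
Proof.
apply: contrapT => T1; apply: (@tree_infinite T).
apply: (@sub_finite_set _ _ [set Defs.root T]%classic) => // v _ /=.
by apply: contrapT => v0; apply: T1; exists v.
Qed.

Theorem corollary2p9 (R : realType) (T : rooted_tree)
  (X : discrete_function_space R T)
  (hD : bounded_on X (@derivative T R)) :
  1 - opnorm X (@comp_shift T R) <= opnorm X (@derivative T R)
  /\ opnorm X (@derivative T R) <= 1 + opnorm X (@comp_shift T R).
Proof.
have CE (u : T -> R[i]) v : comp_shift u v = u v - derivative u v.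
  by rewrite /derivative subKr.
have bC := bounded_on_complement CE hD.
have [v v0] := tree_two_vertices T; have [f f1] := exists_unit_vector X v0.
split; first exact: opnorm_complement_lb f1 CE hD bC.
exact: opnorm_complement_ub CE hD bC.
Qed.
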